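(* Let $T_{dt}$ be the theory of dense trees in the language $\{<,\wedge\}$ and let $M\models T_{dt}$ be countable. Then $\mathrm{Aut}(M)$ has no shifty automorphism. In particular, $M$ has no canonical independence relation. Furthermore, the same is true for the theory $T_{dt,<_{\mathrm{lex}}}$: its countable model $N$, the lexicographically ordered dense tree, has no shifty automorphism, and in particular has no canonical independence relation.
   Context: A meet tree is a structure $(T,<,\wedge)$ where $<$ is a partial order such that for every $a$ the set $\{x: x\le a\}$ is linearly ordered, and $x\wedge y$ is the greatest element which is $\le x$ and $\le y$. $T_{dt}$ is the model completion of the universal theory of meet trees; it is $\omega$-categorical and its countable model is the Fraïssé limit of the class of finite meet trees. Consider $\omega^{<\omega}$ with $<$ the strict tree order (proper initial segment), $s\wedge t$ the longest common initial segment, and $s<_{\mathrm{lex}}t$ iff $s<t$ or $s(\ell)<t(\ell)$ where $\ell$ is the length of $s\wedge t$. The class of finite(ly generated) $\{<,<_{\mathrm{lex}},\wedge\}$-structures embeddable in it is a Fraïssé class; $N$ is its Fraïssé limit and $T_{dt,<_{\mathrm{lex}}}=\mathrm{Th}(N)$, which is $\omega$-categorical. For tuples in a structure $M$, $a\equiv b$ means $\mathrm{tp}(a/\emptyset)=\mathrm{tp}(b/\emptyset)$ and $a\equiv_C b$ means $\mathrm{tp}(a/C)=\mathrm{tp}(b/C)$. Juxtaposition of sets denotes union; $A\downarrow B$ means $A\downarrow_\emptyset B$. For a countable structure $M$, an automorphism $\sigma\in\mathrm{Aut}(M)$ is shifty if there is an $\mathrm{Aut}(M)$-invariant binary relation $\downarrow$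 on finite subsets of $M$ (applied to finite tuples via the sets they enumerate) such that: (Monotonicity) if $A\downarrow B$, $A'\subseteq A$, $B'\subseteq B$, then $A'\downarrow B'$; (Right existence) for every finite tuple $a$ there is $a'\equiv a$ such that $a\downarrow a'$; (Right shiftiness) if $A$ is finite and $b,b'$ are finite tuples such that $b'\equiv b$ and $A\downarrow b'$, then there is $n<\omega$ such that $b'\equiv_A\sigma^n(b)$. A ternary relation $A\downarrow_C B$ on finite subsets of a countable structure $M$, invariant under $\mathrm{Aut}(M)$, is a canonical independence relation (CIR) if for all finite $A,B,C,D\subseteq M$: (Stationarity over $\emptyset$) if $A\downarrow B$, $A'\downarrow B'$, $a,b,a',b'$ are tuples enumerating $A,B,A',B'$, and $a\equiv a'$, $b\equiv b'$, then $ab\equiv a'b'$; (Extension on the right) if $A\downarrow_C B$ then for every finite tuple $d$ there is $d'\equiv_{BC}d$ such that $A\downarrow_C B\cup d'$; (Transitivity on both sides) if $A\downarrow_{DC}B$ and $D\downarrow_C B$ then $AD\downarrow_C B$; and if $A\downarrow_{DC}B$ and $A\downarrow_C D$ then $A\downarrow_C BD$; (Monotonicity) if $A\downarrow_C B$, $A'\subseteq A$, $B'\subseteq B$ then $A'\downarrow_C B'$; (Existence) $A\downarrow_C C$ and $C\downarrow_C A$. (Neither symmetry nor base monotonicity is required.) *)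

(* Defs.v *)
From mathcomp Require Import all_boot.
From mathcomp Require Import boolp classical_sets functions cardinality.

Set Implicit Arguments.
Unset Strict Implicit.
Unset Printing Implicit Defensive.

Local Open Scope classical_set_scope.

Record language := Language {
  fsym : Type;
  rsym : Type;
  farity : fsym -> nat;
  rarity : rsym -> nat }.

(* Variables come from an arbitrary type [V]: [form L void] is the type of
   sentences, [form L 'I_n] that of formulas in n free variables, and
   [form L A] that of sentences of L(A), the elements of A serving as names
   for themselves.  The variable bound by [All] is the [None] of [option V]. *)
Inductive term (L : language) (V : Type) : Type :=
| Var of V
| App (f : fsym L) of ('I_(farity f) -> term L V).

Inductive form (L : language) (V : Type) : Type :=
| Bot
| Eql of term L V & term L V
| Rel (r : rsym L) of ('I_(rarity r) -> term L V)
| Imp of form L V & form L V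
| All of form L (option V).

Arguments Var {L V}.
Arguments App {L V}.
Arguments Bot {L V}.
Arguments Eql {L V}.
Arguments Rel {L V}.
Arguments Imp {L V}.
Arguments All {L V}.

Record structure (L : language) := Structure {
  carrier :> Type;
  carrier_inhabited : inhabited carrier;
  finterp : forall f : fsym L, ('I_(farity f) -> carrier) -> carrier;
  rinterp : forall r : rsym L, ('I_(rarity r) -> carrier) -> Prop }.

Section Semantics.
Variable L : language.

Fixpoint eval (M : structure L) V (e : V -> M) (t : term L V) : M :=
  match t with
  | Var v => e v
  | App f ts => @finterp L M f (fun i => eval e (ts i))
  end.

Fixpoint sat (M : structure L) V (e : V -> M) (phi : form L V) : Prop :=
  match phi with
  | Bot => False
  | Eql t u => eval e t = eval e u
  | Rel r ts => @rinterp L M r (fun i => eval e (ts i))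
  | Imp p q => sat e p -> sat e q
  | All p => forall x : M, sat (oapp e x) p
  end.

Fixpoint qfree V (phi : form L V) : Prop :=
  match phi with
  | Imp p q => qfree p /\ qfree q
  | All _ => False
  | _ => True
  end.

Fixpoint universal V (phi : form L V) : Prop :=
  match phi with
  | All p => universal p
  | _ => qfree phi
  end.

Definition theory := set (form L void).

Definition holds (M : structure L) (phi : form L void) : Prop :=
  sat (fun v : void => match v return M with end) phi.

Definition models (M : structure L) (T : theory) : Prop :=
  forall phi, T phi -> holds M phi.

Definition Th (M : structure L) : theory := [set phi | holds M phi].

Definition embedding (A B : structure L) (h : A -> B) : Prop :=
  [/\ injective h,
      forall (f : fsym L) (a : 'I_(farity f) -> A),
        h (finterp a) = finterp (h \o a)
    & forall (r : rsym L) (a : 'I_(rarity r) -> A),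
        rinterp a <-> rinterp (h \o a)].

Definition automorphism (M : structure L) (s : M -> M) : Prop :=
  embedding s /\ bijective s.

Definition elementary (A B : structure L) (h : A -> B) : Prop :=
  forall V (e : V -> A) (phi : form L V), sat e phi <-> sat (h \o e) phi.

Definition diagram (A : structure L) : set (form L A) :=
  [set phi | qfree phi /\ sat (M := A) id phi].
Arguments diagram A : clear implicits.

(* An L(A)-structure is an L-structure [B] with an interpretation [c : A -> B]
   of the new constants. *)
Definition models_with_diagram (T : theory) (A B : structure L) (c : A -> B) :=
  models B T /\ forall phi, diagram A phi -> sat c phi.

Definition complete_with_diagram (T : theory) (A : structure L) : Prop :=
  (exists (B : structure L) (c : A -> B), models_with_diagram T c) /\
  forall phi : form L A,
    (forall (B : structure L) (c : A -> B),
        models_with_diagram T c -> sat c phi) \/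
    (forall (B : structure L) (c : A -> B),
        models_with_diagram T c -> ~ sat c phi).

Definition model_consistent (T T' : theory) : Prop :=
  forall A : structure L, models A T ->
    exists (B : structure L) (h : A -> B), models B T' /\ embedding h.

Definition model_complete (T : theory) : Prop :=
  forall (A B : structure L) (h : A -> B),
    models A T -> models B T -> embedding h -> elementary h.

Definition model_companion (T T' : theory) : Prop :=
  [/\ model_consistent T T', model_consistent T' T & model_complete T'].

Definition model_completion (T T' : theory) : Prop :=
  model_companion T T' /\
  forall A : structure L, models A T -> complete_with_diagram T' A.

Definition finitely_generated (A : structure L) : Prop :=
  exists (n : nat) (a : 'I_n -> A),
    forall x : A, exists t : term L 'I_n, eval a t = x.

Definition age (M : structure L) : set (structure L) :=
  [set A | finitely_generated A /\ exists h : A -> M, embedding h].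

(* [g \o h^-1] is the general form of an isomorphism between two finitely
   generated substructures. *)
Definition ultrahomogeneous (M : structure L) : Prop :=
  forall (A : structure L) (g h : A -> M),
    finitely_generated A -> embedding g -> embedding h ->
    exists s : M -> M, automorphism s /\ forall x, s (h x) = g x.

Definition fraisse_limit (K : set (structure L)) (M : structure L) : Prop :=
  [/\ countable [set: M], age M = K & ultrahomogeneous M].

(* A tuple of elements of X is a function [I -> X]; concatenation is indexed
   by the disjoint sum. *)
Definition tcat X I J (a : I -> X) (b : J -> X) : I + J -> X :=
  fun k => match k with inl i => a i | inr j => b j end.

Definition tp (M : structure L) (C : set M) I (a : I -> M) :
    set (form L (I + {x : M | C x})) :=
  [set phi | sat (tcat a sval) phi].
Arguments tp {M} C {I} a.

Definition tp_eq_over (M : structure L) (C : set M) I (a b : I -> M) : Prop :=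
  tp C a = tp C b.

Definition tp_eq (M : structure L) I (a b : I -> M) : Prop :=
  tp_eq_over set0 a b.

(* Finite subsets are [set M] with [finite_set]; the values of [ind] on other
   sets are irrelevant.  The set enumerated by a tuple [a] is [range a]. *)
Record shifty_witness (M : structure L) (s : M -> M)
    (ind : set M -> set M -> Prop) : Prop := ShiftyWitness {
  shifty_invariance : forall (g : M -> M) (A B : set M),
    automorphism g -> finite_set A -> finite_set B ->
    (ind A B <-> ind (g @` A) (g @` B));
  shifty_monotonicity : forall A B A' B' : set M,
    finite_set A -> finite_set B ->
    ind A B -> A' `<=` A -> B' `<=` B -> ind A' B';
  shifty_right_existence : forall n (a : 'I_n -> M),
    exists a' : 'I_n -> M, tp_eq a' a /\ ind (range a) (range a');
  right_shiftiness : forall (A : set M) n (b b' : 'I_n -> M),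
    finite_set A -> tp_eq b' b -> ind A (range b') ->
    exists k : nat, tp_eq_over A b' (iter k s \o b) }.

Definition shifty (M : structure L) (s : M -> M) : Prop :=
  automorphism s /\ exists ind, shifty_witness s ind.

(* [ind C A B] is "A is independent from B over C". *)
Record canonical_independence_relation (M : structure L)
    (ind : set M -> set M -> set M -> Prop) : Prop := CIR {
  cir_invariance : forall (g : M -> M) (A B C : set M),
    automorphism g -> finite_set A -> finite_set B -> finite_set C ->
    (ind C A B <-> ind (g @` C) (g @` A) (g @` B));
  cir_stationarity : forall m n (a a' : 'I_m -> M) (b b' : 'I_n -> M),
    ind set0 (range a) (range b) -> ind set0 (range a') (range b') ->
    tp_eq a a' -> tp_eq b b' -> tp_eq (tcat a b) (tcat a' b');
  cir_extension_right : forall A B C : set M,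
    finite_set A -> finite_set B -> finite_set C -> ind C A B ->
    forall n (d : 'I_n -> M), exists d' : 'I_n -> M,
      tp_eq_over (B `|` C) d' d /\ ind C A (B `|` range d');
  cir_transitivity_left : forall A B C D : set M,
    finite_set A -> finite_set B -> finite_set C -> finite_set D ->
    ind (D `|` C) A B -> ind C D B -> ind C (A `|` D) B;
  cir_transitivity_right : forall A B C D : set M,
    finite_set A -> finite_set B -> finite_set C -> finite_set D ->
    ind (D `|` C) A B -> ind C A D -> ind C A (B `|` D);
  cir_monotonicity : forall A B C A' B' : set M,
    finite_set A -> finite_set B -> finite_set C ->
    ind C A B -> A' `<=` A -> B' `<=` B -> ind C A' B';
  cir_existence : forall A C : set M,
    finite_set A -> finite_set C -> ind C A C /\ ind C C A }.

End Semantics.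

Variant meet_fun := Meet.
Variant tree_rel := Lt.

Definition tree_lang : language := {|
  fsym := meet_fun; rsym := tree_rel;
  farity := fun=> 2; rarity := fun=> 2 |}.

Definition pair2 X (x y : X) : 'I_2 -> X :=
  fun i => if i == ord0 then x else y.

Definition tlt (M : structure tree_lang) (x y : M) : Prop :=
  @rinterp tree_lang M Lt (pair2 x y).
Definition tle (M : structure tree_lang) (x y : M) : Prop := tlt x y \/ x = y.
Definition tmeet (M : structure tree_lang) (x y : M) : M :=
  @finterp tree_lang M Meet (pair2 x y).

Definition meet_tree (M : structure tree_lang) : Prop :=
  [/\ forall x : M, ~ tlt x x,
      forall x y z : M, tlt x y -> tlt y z -> tlt x z,
      forall a x y : M, tle x a -> tle y a -> tle x y \/ tle y x
    & forall x y : M,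
        [/\ tle (tmeet x y) x, tle (tmeet x y) y
          & forall z, tle z x -> tle z y -> tle z (tmeet x y)]].

Definition meet_tree_theory : theory tree_lang :=
  [set phi | universal phi /\ forall M, meet_tree M -> holds M phi].

Variant lextree_rel := LexLt | LexLex.

Definition lextree_lang : language := {|
  fsym := meet_fun; rsym := lextree_rel;
  farity := fun=> 2; rarity := fun=> 2 |}.

Definition strict_prefix (s t : seq nat) : bool := prefix s t && (s != t).

Fixpoint common_prefix (s t : seq nat) : seq nat :=
  match s, t with
  | x :: s', y :: t' => if x == y then x :: common_prefix s' t' else [::]
  | _, _ => [::]
  end.

(* If the common prefix is all of [s] or all of [t], then [s(l)] or [t(l)] is
   undefined, and the second disjunct is false. *)
Definition seq_lex (s t : seq nat) : bool :=
  let l := size (common_prefix s t) in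
  strict_prefix s t ||
  [&& l < size s, l < size t & nth 0 s l < nth 0 t l].

Definition omega_tree : structure lextree_lang := {|
  carrier := seq nat;
  carrier_inhabited := inhabits [::];
  finterp := fun (_ : fsym lextree_lang) (a : 'I_2 -> seq nat) =>
    common_prefix (a ord0) (a ord_max);
  rinterp := fun (r : rsym lextree_lang) (a : 'I_2 -> seq nat) =>
    match r with
    | LexLt => strict_prefix (a ord0) (a ord_max)
    | LexLex => seq_lex (a ord0) (a ord_max)
    end |}.

(* Main.v *)
(* Let [s] be shifty and choose [m] comparable to [s m].  If [m <= s m], then
   [m <= s^k m] for all [k]; since all points are conjugate, right shiftiness
   forces [x <= y] whenever [x] is independent from [y].  A right-independent copy
   [q0, q1] of an incomparable pair [p0, p1] would then have [p0, p1 <= q0],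
   which is absurd in a tree; the case [s m <= m] is dual.

   For a canonical independence relation, stationarity makes all independent
   pairs of points alike, and the same argument shows that they are
   incomparable.  Three points [x0], [x1], [x2], each independent from the next
   and with [x0] independent from [x2] over [x1], contradict transitivity
   applied to the meets [x0 /\ x1] and [x1 /\ x2].

   That all points are conjugate, and more generally that types of finite tuples
   determine orbits, follows from quantifier elimination and countability by a
   back-and-forth construction: in a finite relational language with meets, the
   quantifier-free type of a tuple is given by finitely many formulas.
   Quantifier elimination comes from completeness with diagrams for dense trees,
   and from ultrahomogeneity of the limit for lexicographic trees. *)
Require Import Defs.
From mathcomp Require Import all_boot.
From mathcomp Require Import boolp classical_sets functions cardinality.

Set Implicit Arguments.
Unset Strict Implicit.
Unset Printing Implicit Defensive.

Local Open Scope classical_set_scope.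

(** * Renaming of variables, closures, types and generated substructures *)

Section Syntax.
Variable L : language.

Fixpoint trename (V W : Type) (f : V -> W) (t : term L V) : term L W :=
  match t with
  | Var v => Var (f v)
  | App g ts => App g (fun i => trename f (ts i))
  end.

Fixpoint frename (V : Type) (phi : form L V) : forall W : Type, (V -> W) -> form L W :=
  match phi with
  | Bot => fun W f => Bot
  | Eql t u => fun W f => Eql (trename f t) (trename f u)
  | Rel r ts => fun W f => Rel r (fun i => trename f (ts i))
  | Imp p q => fun W f => Imp (frename p f) (frename q f)
  | All p => fun W f => All (frename p (omap f))
  end.

Lemma eval_rename (M : structure L) (V W : Type) (f : V -> W) (e : W -> M)
    (t : term L V) :
  eval e (trename f t) = eval (e \o f) t.
Proof.
elim: t => [//|g ts IH] /=.
by congr finterp; apply/funext => i; exact: IH.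
Qed.

Lemma sat_rename (M : structure L) (V : Type) (phi : form L V) (W : Type)
    (f : V -> W) (e : W -> M) :
  sat e (frename phi f) <-> sat (e \o f) phi.
Proof.
elim: phi W f e => {V} [V|V t u|V r ts|V p IHp q IHq|V p IHp] W f e //=.
- by rewrite !eval_rename.
- suff -> : (fun i => eval e (trename f (ts i))) =
            (fun i => eval (e \o f) (ts i)) by [].
  by apply/funext => i; rewrite eval_rename.
- by rewrite IHp IHq.
- have E x : oapp e x \o omap f = oapp (e \o f) x by apply/funext => -[].
  by split=> H x; move: (H x); rewrite IHp E.
Qed.

Lemma qfree_rename (V : Type) (phi : form L V) (W : Type) (f : V -> W) :
  qfree phi -> qfree (frename phi f).
Proof.
by elim: phi W f => //= {}V p IHp q IHq W f [/IHp hp /IHq hq].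
Qed.

(* ['I_n] does not live in [Set], the universe of the variables of [universal]. *)
Fixpoint vars (n : nat) : Set := if n is m.+1 then option (vars m) else void.

Fixpoint var n : 'I_n -> vars n :=
  match n with
  | 0 => fun i => False_rect void (elimF idP (ltn0 i) (ltn_ord i))
  | m.+1 => fun i => omap (@var m) (unlift ord0 i)
  end.

Fixpoint forall_vars n : form L (vars n) -> form L void :=
  match n with
  | 0 => id
  | _.+1 => fun phi => forall_vars (All phi)
  end.

Lemma holds_forall_vars (M : structure L) n (phi : form L (vars n)) :
  holds M (forall_vars phi) <-> forall e : vars n -> M, sat e phi.
Proof.
elim: n phi => [|n IH] phi /=.
  split=> [H e|]; last exact.
  by move: H; congr (sat _ _); apply/funext => -[].
rewrite IH; split=> H e; last by move=> x; exact: H.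
have := H (e \o Some) (e None).
by congr (sat _ _); apply/funext => -[].
Qed.

Lemma universal_forall_vars n (phi : form L (vars n)) :
  universal phi -> universal (forall_vars phi).
Proof. by elim: n phi => [//|n IH] phi H /=; exact: IH. Qed.

Lemma extend_var T (x : T) n (e : 'I_n -> T) : exists e', e = e' \o @var n.
Proof.
elim: n e => [|n IH] e.
  by exists (fun _ => x); apply/funext => -[].
have [e' e'E] := IH (e \o lift ord0).
exists (oapp e' (e ord0)); apply/funext => i /=.
by case: unliftP => [j ->|->] //=; rewrite -[RHS]/((e' \o @var n) j) -e'E.
Qed.

Definition fclose n (phi : form L 'I_n) : form L void :=
  forall_vars (frename phi (@var n)).

Lemma holds_fclose (M : structure L) n (phi : form L 'I_n) :
  holds M (fclose phi) <-> forall e : 'I_n -> M, sat e phi.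
Proof.
rewrite holds_forall_vars; split=> H e; last exact/sat_rename.
have [x] := carrier_inhabited M; have [e' ->] := extend_var x e.
exact/sat_rename.
Qed.

Lemma universal_fclose n (phi : form L 'I_n) :
  qfree phi -> universal (fclose phi).
Proof.
move=> H; apply: universal_forall_vars.
by move: (qfree_rename (@var n) H); case: frename.
Qed.

Lemma elementarily_equivalent_sat (M N : structure L) n (phi : form L 'I_n) :
  models M (Th N) -> (forall e : 'I_n -> N, sat e phi) ->
  forall e : 'I_n -> M, sat e phi.
Proof. by move=> MN /holds_fclose/MN/holds_fclose. Qed.

Definition Not (V : Type) (p : form L V) := Imp p Bot.
Definition And (V : Type) (p q : form L V) := Not (Imp p (Not q)).
Definition Or (V : Type) (p q : form L V) := Imp (Not p) q.
Definition Ex (V : Type) (p : form L (option V)) := Not (All (Not p)).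
Definition Bigand (V : Type) (I : finType) (F : I -> form L V) :=
  foldr (fun i => And (F i)) (Not Bot) (enum I).

Section SatConnectives.
Variables (M : structure L) (V : Type) (e : V -> M).

Lemma sat_And p q : sat e (And p q) <-> sat e p /\ sat e q.
Proof.
split=> [/= H|[hp hq] /= H]; last exact: H.
by split; apply: contrapT => hn; apply: H.
Qed.

Lemma sat_Or p q : sat e (Or p q) <-> sat e p \/ sat e q.
Proof.
split=> /= [H|[hp|hq] hn] //.
by case: (pselect (sat e p)) => [|/H]; [left|right].
Qed.

Lemma sat_Ex p : sat e (Ex p) <-> exists x, sat (oapp e x) p.
Proof.
split=> [/= H|[x hx] /= H]; last exact: H hx.
by apply: contrapT => hn; apply: H => x hx; apply: hn; exists x.
Qed.

Lemma sat_Bigand (I : finType) (F : I -> form L V) :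
  sat e (Bigand F) <-> forall i, sat e (F i).
Proof.
rewrite /Bigand; suff H (s : seq I) :
    sat e (foldr (fun i => And (F i)) (Not Bot) s) <->
    forall i, i \in s -> sat e (F i).
  by rewrite H; split=> h i; [apply: h; rewrite mem_enum|move=> _; exact: h].
elim: s => [|i s IH]; first by split=> [_ i|_ /=].
apply: (iff_trans (sat_And _ _)); rewrite IH; split.
  by move=> [hi hs] j; rewrite inE => /orP[/eqP ->//|]; exact: hs.
by move=> h; split=> [|j hj]; apply: h; rewrite inE ?eqxx ?hj ?orbT.
Qed.

End SatConnectives.

(** Equality of types over the empty set, for tuples that may lie in different structures. *)
Definition eqv (M N : structure L) (V : Type) (a : V -> M) (b : V -> N) :=
  forall phi : form L V, sat a phi <-> sat b phi.

Definition qf_eqv (M N : structure L) (V : Type) (a : V -> M) (b : V -> N) :=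
  forall phi : form L V, qfree phi -> (sat a phi <-> sat b phi).

Lemma tp_eq_eqv (M : structure L) (V : Type) (a b : V -> M) : tp_eq a b <-> eqv a b.
Proof.
split=> [H phi|H].
  have E (c : V -> M) : sat c phi <-> tp (C := set0) c (frename phi inl).
    by rewrite /tp /= sat_rename.
  by rewrite !E H.
apply/funext => phi; apply/propext; rewrite /tp /=.
pose f (v : V + {x : M | set0 x}) := match v with
  | inl i => i | inr x => False_rect V (proj2_sig x) end.
have E (c : V -> M) : sat (tcat c sval) phi <-> sat c (frename phi f).
  rewrite sat_rename; suff -> : tcat c sval = c \o f by [].
  by apply/funext => -[|[]].
by rewrite !E.
Qed.

(** The extra coordinates listed by [c] are replaced by names of elements of [C], over which the two
    types agree. *)
Lemma tp_eq_over_eqv (M : structure L) (C : set M) (V W : Type)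
    (a b : V -> M) (c : W -> M) :
  (forall w, C (c w)) -> tp_eq_over C a b -> eqv (tcat a c) (tcat b c).
Proof.
move=> hc H phi.
pose f (v : V + W) : V + {x : M | C x} := match v with
  | inl i => inl i | inr w => inr (exist _ (c w) (hc w)) end.
have E (d : V -> M) : sat (tcat d c) phi <-> tp (C := C) d (frename phi f).
  rewrite /tp /= sat_rename; suff -> : tcat d sval \o f = tcat d c by [].
  by apply/funext => -[].
by rewrite !E H.
Qed.

Lemma eqv_comp (M N : structure L) (V W : Type) (a : V -> M) (b : V -> N) (f : W -> V) :
  eqv a b -> eqv (a \o f) (b \o f).
Proof. by move=> H phi; have := H (frename phi f); rewrite !sat_rename. Qed.

Lemma eqv_sym (M N : structure L) (V : Type) (a : V -> M) (b : V -> N) :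
  eqv a b -> eqv b a.
Proof. by move=> H phi; split=> /H. Qed.

Lemma eval_embedding (A B : structure L) (h : A -> B) (V : Type) (e : V -> A) t :
  embedding h -> h (eval e t) = eval (h \o e) t.
Proof.
case=> _ hf _; elim: t => [//|g ts IH] /=.
by rewrite hf; congr finterp; apply/funext => i /=.
Qed.

Lemma qf_embedding (A B : structure L) (h : A -> B) (V : Type) (e : V -> A) :
  embedding h -> qf_eqv e (h \o e).
Proof.
move=> hh phi; have [hi hf hr] := hh.
elim: phi e => {V} [V|V t u|V r ts|V p IHp q IHq|//] e //=.
- by rewrite -!eval_embedding //; split=> [->//|/hi].
- rewrite hr; suff -> : (fun i => eval (h \o e) (ts i)) =
            h \o (fun i => eval e (ts i)) by [].
  by apply/funext => i; rewrite /= eval_embedding.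
- by move=> [qp qq]; rewrite IHp // IHq.
Qed.

Lemma automorphism_elementary (M : structure L) (s : M -> M) :
  automorphism s -> elementary s.
Proof.
move=> [hs [s' sK s'K]] V e phi; have [hi hf hr] := hs.
elim: phi e => {V} [V|V t u|V r ts|V p IHp q IHq|V p IHp] e //=.
- exact: (qf_embedding e hs (phi := Eql t u)).
- exact: (qf_embedding e hs (phi := Rel r ts)).
- by rewrite IHp IHq.
- have E x : oapp (s \o e) (s x) = s \o oapp e x by apply/funext => -[].
  split=> H x; first by rewrite -(s'K x) E -IHp.
  by rewrite IHp -E.
Qed.

(** The carrier is the set of values of terms at [a]. Sending the value of a term at [a] to its
    value at [b] is well defined and injective because equations between terms are quantifier-free;
    [v0] makes the carrier inhabited. *)
Lemma generated_substructure (M N : structure L) (V : Type) (v0 : V)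
    (a : V -> M) (b : V -> N) : qf_eqv a b ->
  exists (A : structure L) (c : V -> A) (h : A -> M) (k : A -> N),
    [/\ embedding h, embedding k, h \o c = a, k \o c = b
      & forall x, exists t, eval c t = x].
Proof.
move=> ab.
pose X := {x : M | exists t : term L V, eval a t = x}.
pose tm (x : X) : term L V := sval (cid (svalP x)).
have tmE x : eval a (tm x) = sval x by rewrite /tm; case: cid.
pose mk t : X := exist _ (eval a t) (ex_intro _ t erefl).
pose fX (f : Defs.fsym L) (x : 'I_(farity f) -> X) := mk (App f (tm \o x)).
pose rX (r : rsym L) (x : 'I_(rarity r) -> X) := rinterp (sval \o x).
pose c v := mk (Var v).
pose A := Structure (inhabits (c v0)) fX rX.
have abt t u : eval a t = eval a u <-> eval b t = eval b u.
  exact: (ab (Eql t u) I).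
have hX : @embedding L A M sval.
  split=> [[x hx] [y hy] /= e|f x|r x] //.
    by case: _ / e hy => hy; congr exist; exact: Prop_irrelevance.
  by rewrite /=; congr finterp; apply/funext => i; rewrite /= tmE.
have kE (x : X) t : sval x = eval a t -> eval b (tm x) = eval b t.
  by move=> xt; apply/abt; rewrite tmE.
exists A, c, sval, (fun x => eval b (tm x)); split=> //.
- split=> [x y /abt|f x|r x].
  + by rewrite !tmE; case: hX => + _ _ => /[apply].
  + exact: (kE _ (App f (tm \o x))).
  + rewrite /= /rX (_ : sval \o x = (fun i => eval a (tm (x i)))).
      exact: (ab (Rel r (tm \o x)) I).
    by apply/funext => i; rewrite tmE.
- by apply/funext => v; exact: (kE _ (Var v)).
- move=> x; exists (tm x); case: (hX) => + _ _; apply.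
  by rewrite (eval_embedding _ _ hX) -tmE.
Qed.

(** One formula records the truth values of finitely many formulas at [x], so the existence of a
    point satisfying it passes from [a] to [b]. *)
Lemma isolated_extension (M : structure L) (V : Type) (a b : V -> M) (I : finType)
    (F : I -> form L (option V)) :
  eqv a b -> forall x, exists y, forall i,
    sat (oapp a x) (F i) <-> sat (oapp b y) (F i).
Proof.
move=> ab x.
pose G i := if `[< sat (oapp a x) (F i) >] then F i else Not (F i).
have : sat a (Ex (Bigand G)).
  by apply/sat_Ex; exists x; apply/sat_Bigand => i; rewrite /G; case: asboolP.
move=> /ab/sat_Ex[y /sat_Bigand Gy]; exists y => i.
by have := Gy i; rewrite /G; case: asboolP => h h'; split=> // /h'.
Qed.

End Syntax.
Arguments Not {L V}.
Arguments And {L V}.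
Arguments Or {L V}.
Arguments Ex {L V}.

(** * Back-and-forth on a countable set *)

Section BackAndForth.
Variables (X : choiceType) (P : seq (X * X) -> Prop).
Hypothesis Xcountable : countable [set: X].
Hypothesis functional : forall s x y y',
  P s -> (x, y) \in s -> (x, y') \in s -> y = y'.
Hypothesis cofunctional : forall s x x' y,
  P s -> (x, y) \in s -> (x', y) \in s -> x = x'.
Hypothesis forth : forall s x, P s -> exists y, P ((x, y) :: s).
Hypothesis back : forall s y, P s -> exists x, P ((x, y) :: s).

(** [g] is the union of an increasing chain of finite approximations. Each finite list [l] is
    settled by a single stage, which is how finitary properties of the stages carry over to [g]. *)
Lemma back_and_forth s0 : P s0 ->
  exists g : X -> X, bijective g /\
    forall l : seq X, exists s,
      [/\ P s, {subset s0 <= s} & forall x, x \in l -> (x, g x) \in s].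
Proof.
move=> Ps0.
have [x0|X0] := pselect (inhabited X); last first.
  exists id; split=> [|l]; first by exists id.
  by exists s0; split=> // x; case: X0.
have /countable_injP[f finj] := Xcountable.
have [e fe] : exists e : nat -> X, forall x, e (f x) = x.
  have /choice[e he] n : exists x, forall x', f x' = n -> x' = x.
    case: (pselect (exists x, f x = n)) => [[x <-]|h].
      by exists x => x'; apply: finj; rewrite inE.
    by case: x0 => x; exists x => x' h'; case: h; exists x'.
  by exists e => x; symmetry; exact: he.
(* One step puts the [n]-th point into both the domain and the range. *)
have /choice[F hF] (ns : nat * seq (X * X)) : exists s', P ns.2 ->
    [/\ P s', {subset ns.2 <= s'}, exists y, (e ns.1, y) \in s'
      & exists x, (x, e ns.1) \in s'].
  case: ns => n s /=; case: (pselect (P s)) => [Ps|?]; last by exists s.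
  have [y Py] := forth (e n) Ps; have [x Px] := back (e n) Py.
  exists ((x, e n) :: (e n, y) :: s) => _; split=> //.
  - by move=> p ps; rewrite !inE ps !orbT.
  - by exists y; rewrite !inE eqxx orbT.
  - by exists x; rewrite !inE eqxx.
pose S := fix S n := if n is m.+1 then F (m, S m) else s0.
have PS n : P (S n) by elim: n => [//|n IH]; case: (hF (n, S n) IH).
have Smono m n : m <= n -> {subset S m <= S n}.
  elim: n => [|n IH]; first by rewrite leqn0 => /eqP ->.
  rewrite leq_eqVlt => /orP[/eqP ->//|/IH h p /h].
  by case: (hF (n, S n) (PS n)) => _ /(_ p).
have /choice[g hg] x : exists y, exists n, (x, y) \in S n.
  case: (hF (f x, S (f x)) (PS _)) => _ _ + _.
  by rewrite fe => -[y hy]; exists y, (f x).+1.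
have /choice[h hh] y : exists x, exists n, (x, y) \in S n.
  case: (hF (f y, S (f y)) (PS _)) => _ _ _.
  by rewrite fe => -[x hx]; exists x, (f y).+1.
exists g; split.
  exists h => [x|y].
    have [n hn] := hg x; have [m hm] := hh (g x).
    by apply: (cofunctional (PS (maxn m n))); [exact: Smono (leq_maxl _ _) _ hm|
      exact: Smono (leq_maxr _ _) _ hn].
  have [m hm] := hh y; have [n hn] := hg (h y).
  by apply: (functional (PS (maxn m n))); [exact: Smono (leq_maxr _ _) _ hn|
    exact: Smono (leq_maxl _ _) _ hm].
move=> l; suff [n hn] : exists n, forall x, x \in l -> (x, g x) \in S n.
  by exists (S n); split=> //; exact: (Smono 0).
elim: l => [|x l [n hn]]; first by exists 0.
have [m hm] := hg x; exists (maxn m n) => z; rewrite inE => /orP[/eqP ->|/hn].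
  by exact: Smono (leq_maxl _ _) _ hm.
exact: Smono (leq_maxr _ _) _.
Qed.

End BackAndForth.

(** * Meet trees in languages with one meet and binary relations *)

Definition tree_order (T : Type) (lt : T -> T -> Prop) (meet : T -> T -> T) :=
  let le x y := lt x y \/ x = y in
  [/\ forall x, ~ lt x x,
      forall x y z, lt x y -> lt y z -> lt x z,
      forall a x y, le x a -> le y a -> le x y \/ le y x
    & forall x y,
        [/\ le (meet x y) x, le (meet x y) y
          & forall z, le z x -> le z y -> le z (meet x y)]].

(** Both [tree_lang] and [lextree_lang] are instances, so the arguments about trees serve for
    either; [r0] below is the symbol read as the tree order. *)
Definition binary_lang (R : Type) : language := {|
  Defs.fsym := meet_fun; rsym := R; farity := fun=> 2; rarity := fun=> 2 |}.

Lemma pair2E T (a : 'I_2 -> T) : a = pair2 (a ord0) (a ord_max).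
Proof.
apply/funext => i; rewrite /pair2; case: eqP => [->//|].
by case: i => [[|[|//]]] hi // h; [case: h|congr a]; exact: val_inj.
Qed.

Lemma pair2_comp T U (f : T -> U) (x y : T) : f \o pair2 x y = pair2 (f x) (f y).
Proof. by apply/funext => i; rewrite /= /pair2; case: ifP. Qed.

Section BinaryStructures.
Variables (R : Type) (r0 : R).
Notation L := (binary_lang R).

Definition rel (M : structure L) (r : R) (x y : M) : Prop :=
  @rinterp L M r (pair2 x y).
Definition meet (M : structure L) (x y : M) : M :=
  @finterp L M Meet (pair2 x y).

Definition tree (M : structure L) := tree_order (@rel M r0) (@meet M).

Definition meet_term V (t u : term L V) : term L V :=
  @App L V Meet (pair2 t u).
Definition rel_form V (r : R) (t u : term L V) : form L V :=
  @Rel L V r (pair2 t u).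
Definition le_form V (t u : term L V) : form L V := Or (rel_form r0 t u) (Eql t u).

Definition le (M : structure L) (x y : M) := rel r0 x y \/ x = y.

Lemma eval_meet (M : structure L) V (e : V -> M) (t u : term L V) :
  eval e (meet_term t u) = meet (eval e t) (eval e u).
Proof.
rewrite /= /meet; congr (@finterp L M Meet _).
exact: (pair2_comp (eval e)).
Qed.

Lemma sat_rel (M : structure L) V (e : V -> M) r (t u : term L V) :
  sat e (rel_form r t u) <-> rel r (eval e t) (eval e u).
Proof.
rewrite /rel /= -(pair2_comp (eval e)).
by split.
Qed.

Lemma sat_le (M : structure L) V (e : V -> M) (t u : term L V) :
  sat e (le_form t u) <-> le (eval e t) (eval e u).
Proof. by rewrite sat_Or sat_rel. Qed.

Lemma eqv_meet (M N : structure L) V (a : V -> M) (b : V -> N) i j k :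
  eqv a b -> a k = meet (a i) (a j) -> b k = meet (b i) (b j).
Proof.
move=> /(_ (Eql (Var k) (meet_term (Var i) (Var j)))) /=.
by rewrite -!(eval_meet _ (Var i) (Var j)) => -[].
Qed.

Lemma eqv_rel (M N : structure L) V (a : V -> M) (b : V -> N) r i j :
  eqv a b -> (rel r (a i) (a j) <-> rel r (b i) (b j)).
Proof. by move=> /(_ (rel_form r (Var i) (Var j))); rewrite !sat_rel. Qed.

Lemma eqv_eq (M N : structure L) V (a : V -> M) (b : V -> N) i j :
  eqv a b -> (a i = a j <-> b i = b j).
Proof. by move=> /(_ (Eql (Var i) (Var j))). Qed.

Lemma eqv_le (M N : structure L) V (a : V -> M) (b : V -> N) i j :
  eqv a b -> (le (a i) (a j) <-> le (b i) (b j)).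
Proof. by move=> ab; rewrite /le (eqv_rel r0 i j ab) (eqv_eq i j ab). Qed.

Lemma embedding_le (M N : structure L) (h : M -> N) x y :
  embedding h -> (le x y <-> le (h x) (h y)).
Proof.
move=> [hi _ hr]; rewrite /le /rel (hr r0) pair2_comp.
by split=> -[]; [left|right; congr h|left|right; exact: hi].
Qed.

(** A single quantifier-free formula, so that the tree axioms descend to substructures. Here [z]
    serves both as the upper bound in the comparability axiom and as the lower bound in the meet
    axiom. *)
Definition tree_form : form L 'I_3 :=
  let x := Var ord0 in let y := Var (inord 1) in let z := Var ord_max in
  And (Not (rel_form r0 x x))
 (And (Imp (rel_form r0 x y) (Imp (rel_form r0 y z) (rel_form r0 x z)))
 (And (Imp (le_form x z) (Imp (le_form y z) (Or (le_form x y) (le_form y x))))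
 (And (le_form (meet_term x y) x)
 (And (le_form (meet_term x y) y)
      (Imp (le_form z x) (Imp (le_form z y) (le_form z (meet_term x y)))))))).

Lemma qfree_tree_form : qfree tree_form.
Proof. by []. Qed.

Lemma sat_tree_form (M : structure L) :
  tree M <-> forall e : 'I_3 -> M, sat e tree_form.
Proof.
have E (e : 'I_3 -> M) :
    let x := e ord0 in let y := e (inord 1) in let z := e ord_max in
    sat e tree_form <->
    ~ rel r0 x x /\ (rel r0 x y -> rel r0 y z -> rel r0 x z) /\
    (le x z -> le y z -> le x y \/ le y x) /\
    le (meet x y) x /\ le (meet x y) y /\
    (le z x -> le z y -> le z (meet x y)).
  rewrite /tree_form !sat_And /Not.
  repeat change (sat e (Imp ?p ?q)) with (sat e p -> sat e q).
  by rewrite !sat_rel !sat_le sat_Or !sat_le !eval_meet.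
split=> [[irr tr cmp mt] e|H].
  apply/E; have [m1 m2 m3] := mt (e ord0) (e (inord 1)).
  split; first exact: irr.
  split; first exact: tr.
  split; first exact: cmp.
  by do 2 split=> //; exact: m3.
pose e3 x y z : 'I_3 -> M := fun i =>
  if i == ord0 then x else if i == ord_max then z else y.
have {E H} H (x y z : M) : ~ rel r0 x x /\ (rel r0 x y -> rel r0 y z -> rel r0 x z) /\
    (le x z -> le y z -> le x y \/ le y x) /\
    le (meet x y) x /\ le (meet x y) y /\
    (le z x -> le z y -> le z (meet x y)).
  have /E := H (e3 x y z).
  by rewrite /e3 -!val_eqE /= inordK.
split.
- by move=> x; case: (H x x x).
- by move=> x y z; case: (H x y z) => _ [].
- by move=> a x y; case: (H x y a) => _ [_ []].
- move=> x y; case: (H x y x) => _ [_ [_ [m1 [m2 _]]]]; split=> // z.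
  by case: (H x y z) => _ [_ [_ [_ [_]]]].
Qed.


Section TreeFacts.
Variables (M : structure L) (treeM : tree M).
Implicit Types x y z : M.

Lemma le_refl x : le x x.
Proof. by right. Qed.

Lemma le_trans x y z : le x y -> le y z -> le x z.
Proof.
case: treeM => _ tr _ _ [xy|-> //] [yz|<-]; last by left.
by left; exact: tr xy yz.
Qed.

Lemma le_antisym x y : le x y -> le y x -> x = y.
Proof.
case: treeM => irr tr _ _ [xy|//] [yx|//].
by case: (irr x); exact: tr xy yx.
Qed.

Lemma le_total_below z x y : le x z -> le y z -> le x y \/ le y x.
Proof. by case: treeM => _ _ cmp _; exact: cmp. Qed.

Lemma meet_lel x y : le (meet x y) x.
Proof. by case: treeM => _ _ _ /(_ x y)[]. Qed.

Lemma meet_ler x y : le (meet x y) y.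
Proof. by case: treeM => _ _ _ /(_ x y)[]. Qed.

Lemma le_meet x y z : le z x -> le z y -> le z (meet x y).
Proof. by case: treeM => _ _ _ /(_ x y)[_ _]; exact. Qed.

Lemma meetxx x : meet x x = x.
Proof. by apply: le_antisym; [exact: meet_lel|exact: le_meet (le_refl x) (le_refl x)]. Qed.

Lemma meet_le x y : le x y -> meet x y = x.
Proof.
by move=> h; apply: le_antisym; [exact: meet_lel|exact: le_meet (le_refl x) h].
Qed.

(* The meets of [x] with [y] and with [z] are comparable, and the lower one is
   the meet of all three. *)
Lemma meet3 x y z : meet (meet x y) z = meet x y \/ meet (meet x y) z = meet x z.
Proof.
have [h|h] := le_total_below (meet_lel x y) (meet_lel x z).
  by left; apply: meet_le; exact: le_trans h (meet_ler _ _).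
right; apply: le_antisym; apply: le_meet.
- exact: le_trans (meet_lel _ _) (meet_lel _ _).
- exact: meet_ler.
- exact: h.
- exact: meet_ler.
Qed.

(** Applying [meet3] twice drops two of the four points, so pairwise meets are closed under
    [meet]. *)
Lemma meet4 V (a : V -> M) i j k l : exists p q,
  meet (meet (a i) (a j)) (meet (a k) (a l)) = meet (a p) (a q).
Proof.
have A : meet (meet (a i) (a j)) (meet (a k) (a l)) =
         meet (meet (meet (a i) (a j)) (a k)) (a l).
  apply: le_antisym.
    apply: le_meet; first apply: le_meet; first exact: meet_lel.
      exact: le_trans (meet_ler _ _) (meet_lel _ _).
    exact: le_trans (meet_ler _ _) (meet_ler _ _).
  apply: le_meet; first exact: le_trans (meet_lel _ _) (meet_lel _ _).
  apply: le_meet; last exact: meet_ler.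
  exact: le_trans (meet_lel _ _) (meet_ler _ _).
rewrite A; have [->|->] := meet3 (a i) (a j) (a k).
  by have [->|->] := meet3 (a i) (a j) (a l); eexists; eexists.
by have [->|->] := meet3 (a i) (a k) (a l); eexists; eexists.
Qed.

End TreeFacts.

(* The pairwise meets of a tuple form a substructure, so these conditions
   determine the quantifier-free type. *)
Definition meet_eqv (M N : structure L) (V : Type) (a : V -> M) (b : V -> N) :=
  (forall i j k l p q,
     meet (meet (a i) (a j)) (meet (a k) (a l)) = meet (a p) (a q) <->
     meet (meet (b i) (b j)) (meet (b k) (b l)) = meet (b p) (b q)) /\
  (forall r i j k l, rel r (meet (a i) (a j)) (meet (a k) (a l)) <->
                     rel r (meet (b i) (b j)) (meet (b k) (b l))).

Lemma meet_eqv_comp (M N : structure L) (V W : Type) (a : V -> M) (b : V -> N)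
    (f : W -> V) : meet_eqv a b -> meet_eqv (a \o f) (b \o f).
Proof. by move=> [h1 h2]; split=> *; [exact: h1|exact: h2]. Qed.

(** By [meet4] the meet of two pairwise meets is again one, and [meet_eqv] lets the same indices
    serve in both structures. *)
Lemma eval_tree_term (M N : structure L) (V : Type) (a : V -> M) (b : V -> N) t :
  tree M -> tree N -> meet_eqv a b -> exists i j,
    eval a t = meet (a i) (a j) /\ eval b t = meet (b i) (b j).
Proof.
move=> tM tN [ab _]; elim: t => [v|[] ts IH].
  by exists v, v; rewrite !meetxx.
have [i [j [aE bE]]] := IH ord0; have [k [l [aE' bE']]] := IH ord_max.
have [p [q pq]] := meet4 tM a i j k l.
exists p, q; rewrite (pair2E ts) -/(meet_term (ts ord0) (ts ord_max)).
by rewrite !eval_meet aE aE' bE bE' pq; split=> //; apply/ab.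
Qed.

Lemma meet_eqv_qf (M N : structure L) (V : Type) (a : V -> M) (b : V -> N) :
  tree M -> tree N -> meet_eqv a b -> qf_eqv a b.
Proof.
move=> tM tN ab phi; have [eqab relab] := ab.
elim: phi a b ab eqab relab => {V}
  [V|V t u|V r ts|V p IHp q IHq|//] a b ab eqab relab //.
- have [i [j [tE tE']]] := eval_tree_term t tM tN ab.
  have [k [l [uE uE']]] := eval_tree_term u tM tN ab.
  move=> _ /=; rewrite tE uE tE' uE'.
  (* Idempotence doubles the left-hand meets, giving the equations the shape compared by
     [meet_eqv]. *)
  by rewrite -(meetxx tM (meet (a i) (a j))) -(meetxx tN (meet (b i) (b j))).
- have [i [j [tE tE']]] := eval_tree_term (ts ord0) tM tN ab.
  have [k [l [uE uE']]] := eval_tree_term (ts ord_max) tM tN ab.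
  rewrite (pair2E ts) -/(rel_form r (ts ord0) (ts ord_max)) => _.
  by rewrite !sat_rel tE uE tE' uE'.
- by move=> [qp qq] /=; rewrite (IHp a b) // (IHq a b).
Qed.

(** A single point is closed under meet and bears no relation to itself; quantifier elimination will
    then give all points one type. *)
Lemma point_meet_eqv (M N : structure L) (V : Type) (x : M) (y : N) :
  tree M -> tree N ->
  (forall r, ~ rel r x x) -> (forall r, ~ rel r y y) ->
  meet_eqv (fun _ : V => x) (fun _ : V => y).
Proof.
move=> tM tN irx iry; split=> [i j k l p q|r i j k l]; first by rewrite !meetxx.
by rewrite !meetxx //; split=> [/irx|/iry].
Qed.

(** * Quantifier elimination and homogeneity *)

Section FinitelyManyRelations.
Variables (I : finType) (sym : I -> R).
Hypothesis sym_surj : forall r, exists i, sym i = r.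

(** With finitely many relation symbols, [meet_eqv] of finite tuples compares the truth of finitely
    many atomic formulas; this type indexes them. *)
Definition meet_eqv_index (V : finType) : finType :=
  ((V * V) * ((V * V) * (V * V)) + I * ((V * V) * (V * V)))%type.

Definition meet_eqv_form (V : finType) (d : meet_eqv_index V) : form L V :=
  let m (ij : V * V) := meet_term (Var ij.1) (Var ij.2) in
  match d with
  | inl (ij, (kl, pq)) => Eql (meet_term (m ij) (m kl)) (m pq)
  | inr (r, (ij, kl)) => rel_form (sym r) (m ij) (m kl)
  end.

Lemma meet_eqv_formP (M N : structure L) (V : finType) (a : V -> M) (b : V -> N) :
  meet_eqv a b <->
  forall d, sat a (meet_eqv_form d) <-> sat b (meet_eqv_form d).
Proof.
have E1 (K : structure L) (c : V -> K) i j k l p q :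
    sat c (meet_eqv_form (inl ((p, q), ((i, j), (k, l))))) <->
    meet (meet (c p) (c q)) (meet (c i) (c j)) = meet (c k) (c l).
  by rewrite -!(eval_meet c (Var _) (Var _)) -eval_meet.
have E2 (K : structure L) (c : V -> K) r i j k l :
    sat c (meet_eqv_form (inr (r, ((i, j), (k, l))))) <->
    rel (sym r) (meet (c i) (c j)) (meet (c k) (c l)).
  by rewrite -!(eval_meet c (Var _) (Var _)) -sat_rel.
split=> [[h1 h2] [[[? ?] [[? ?] [? ?]]]|[? [[? ?] [? ?]]]]|h].
- by rewrite !E1.
- by rewrite !E2.
- split=> [i j k l p q|r i j k l]; first by rewrite -!E1.
  by have [s <-] := sym_surj r; rewrite -!E2.
Qed.

(** A semantic form: in a tree, [meet_eqv] amounts to equality of quantifier-free types. *)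
Definition quantifier_elimination (M : structure L) :=
  forall n (a b : 'I_n -> M), meet_eqv a b -> eqv a b.

Lemma quantifier_elimination_fin (M : structure L) (V : finType) (a b : V -> M) :
  quantifier_elimination M -> meet_eqv a b -> eqv a b.
Proof.
have E (c : V -> M) : (c \o enum_val) \o enum_rank = c.
  by apply/funext => v /=; rewrite enum_rankK.
by move=> qe /(meet_eqv_comp enum_val)/qe/(eqv_comp enum_rank); rewrite !E.
Qed.

(** For fixed [phi], the statement that [meet_eqv] carries [phi] from one tuple to the other is one
    formula in [n + n] variables, valid in [N] and hence in [M]. *)
Lemma quantifier_elimination_transfer (M N : structure L) :
  models M (Th N) -> quantifier_elimination N -> quantifier_elimination M.
Proof.
move=> MN qe n a b ab; suff H (c d : 'I_n -> M) phi :
    meet_eqv c d -> sat c phi -> sat d phi.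
  by move=> phi; split; apply: H => //; case: ab => h1 h2; split=> *; rewrite ?h1 ?h2.
move=> {a b ab} cd; pose l := @lshift n n; pose r := @rshift n n.
pose G (f : form L 'I_n) :=
  And (Imp (frename f l) (frename f r)) (Imp (frename f r) (frename f l)).
have GE (K : structure L) (e : 'I_(n + n) -> K) f :
    sat e (G f) <-> (sat (e \o l) f <-> sat (e \o r) f).
  by rewrite sat_And /= !sat_rename.
pose Psi := Imp (Bigand (fun d => G (@meet_eqv_form 'I_n d)))
                (Imp (frename phi l) (frename phi r)).
have PsiE (K : structure L) (e : 'I_(n + n) -> K) :
    sat e Psi <-> (meet_eqv (e \o l) (e \o r) -> sat (e \o l) phi -> sat (e \o r) phi).
  rewrite /Psi; change (sat e (Imp ?p ?q)) with (sat e p -> sat e q).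
  rewrite /= sat_Bigand !sat_rename (meet_eqv_formP (e \o l)).
  by split=> h h'; apply: h => i; [apply/GE|apply/GE].
have HN (e : 'I_(n + n) -> N) : sat e Psi by apply/PsiE => /qe/(_ phi)[].
have cl : tcat c d \o fintype.split \o l = c.
  by apply/funext => i /=; rewrite (unsplitK (inl i)).
have dr : tcat c d \o fintype.split \o r = d.
  by apply/funext => i /=; rewrite (unsplitK (inr i)).
have /PsiE := elementarily_equivalent_sat MN HN (tcat c d \o fintype.split).
by rewrite cl dr; exact.
Qed.

(** Finite type-preserving partial maps extend point by point: [isolated_extension] matches the
    finitely many formulas that decide [meet_eqv], and quantifier elimination upgrades this to
    equality of types. *)
Lemma homogeneity (M : structure L) : quantifier_elimination M ->
  countable [set: M] ->
  forall n (a b : 'I_n -> M), tp_eq a b ->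
    exists g, automorphism g /\ forall i, g (a i) = b i.
Proof.
move=> qe ctbl n a b /tp_eq_eqv ab.
pose X := {classic M}.
(* All families drawn from the list are considered, so that order and repetitions do not matter. *)
pose P (s : seq (X * X)) := forall (V : Type) (v : V -> X * X),
  (forall i, v i \in s) -> eqv (fst \o v : V -> M) (snd \o v : V -> M).
have forth s x : P s -> exists y, P ((x, y) :: s).
  move=> Ps; pose v i := tnth (in_tuple s) i.
  have vs i : v i \in s by exact: mem_tnth.
  have /= [y /meet_eqv_formP/(quantifier_elimination_fin qe) H] :=
    isolated_extension (@meet_eqv_form _) (Ps _ v vs) x.
  exists y => V w ws.
  (* [f] reindexes a family from the extended list, [None] standing for the new pair. *)
  have /choice[f fE] i : exists o, w i = oapp v (x, y) o.
    move: (ws i); rewrite inE => /orP[/eqP ->|]; first by exists None.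
    by move=> /(tnthP (in_tuple s))[j ->]; exists (Some j).
  have -> : fst \o w = oapp (fst \o v) x \o f.
    by apply/funext => i /=; rewrite fE; case: (f i).
  have -> : snd \o w = oapp (snd \o v) y \o f.
    by apply/funext => i /=; rewrite fE; case: (f i).
  exact: eqv_comp.
pose swap (p : X * X) := (p.2, p.1).
have swapK : involutive swap by case.
have Pswap s : P s -> P (map swap s).
  move=> Ps V v vs; apply/eqv_sym.
  apply: (Ps V (swap \o v)) => i /=.
  by have /mapP[p ps ->] := vs i; rewrite swapK.
have back s y : P s -> exists x, P ((x, y) :: s).
  move=> /Pswap/(forth _ y)[x /Pswap /=]; rewrite (mapK swapK) => Px.
  by exists x.
have eqP2 s p q : P s -> p \in s -> q \in s -> (p.1 = q.1 <-> p.2 = q.2).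
  move=> Ps ps qs; apply: (@eqv_eq M M _ _ _ (ord0 : 'I_2) ord_max) (Ps _ (pair2 p q) _).
  by move=> i; rewrite /pair2; case: ifP.
have Ps0 : P [seq (a i, b i) | i <- enum 'I_n].
  move=> V v vs.
  have /choice[f fE] i : exists j, v i = (a j, b j).
    by have /mapP[j _ ->] := vs i; exists j.
  have -> : fst \o v = a \o f by apply/funext => i /=; rewrite fE.
  have -> : snd \o v = b \o f by apply/funext => i /=; rewrite fE.
  exact: eqv_comp.
have [||g [gbij H]] := @back_and_forth {classic M} P ctbl _ _ forth back _ Ps0.
- by move=> s x y y' Ps h1 h2; apply/(eqP2 s _ _ Ps h1 h2).
- by move=> s x x' y Ps h1 h2; apply/(eqP2 s _ _ Ps h1 h2).
(* Every finite tuple is covered by one stage, so [g] preserves its type. *)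
have Hg (V : finType) (c : V -> M) : eqv c (g \o c).
  have [s [Ps _ hs]] := H (codom (c : V -> X)).
  by apply: (Ps V (fun i => (c i : X, g (c i)))) => i; apply: hs; exact: codom_f.
exists g; split; first split=> //; first split.
- exact: bij_inj.
- move=> f c.
  pose t : term L (option 'I_2) := @App L _ f (Var \o Some).
  exact/(Hg _ (oapp c (finterp c)) (Eql (Var None) t)).
- by move=> r c; exact: (Hg 'I_2 c (@Rel L _ r Var)).
- move=> i; have [s [Ps s0s hs]] := H [:: a i].
  apply/esym/(eqP2 s (a i, b i) (a i, g (a i)) Ps) => //.
    by apply: s0s; apply/mapP; exists i; rewrite ?mem_enum.
  by apply: hs; rewrite inE.
Qed.


End FinitelyManyRelations.

(** * The obstruction in a homogeneous tree with incomparable points *)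

Section Obstruction.
Variable M : structure L.
Hypothesis treeM : tree M.
Hypothesis one_type : forall x y : M, tp_eq (fun _ : 'I_1 => x) (fun _ => y).
Hypothesis homM : forall n (a b : 'I_n -> M), tp_eq a b ->
  exists g, automorphism g /\ forall i, g (a i) = b i.
Variables p0 p1 : M.
Hypotheses (p01 : ~ le p0 p1) (p10 : ~ le p1 p0).

Let const1 (x : M) : 'I_1 -> M := fun=> x.

Lemma finite_range n (a : 'I_n -> M) : finite_set (range a).
Proof. exact: finite_image. Qed.

Lemma range_const1 x : range (const1 x) = [set x].
Proof.
by apply/seteqP; split=> [_ [? _ <-] //|_ ->]; exists ord0.
Qed.

Lemma tp_eq_over_le (C : set M) n (a b : 'I_n -> M) (c : M) i :
  C c -> tp_eq_over C a b ->
  (le c (a i) <-> le c (b i)) /\ (le (a i) c <-> le (b i) c).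
Proof.
move=> Cc /(@tp_eq_over_eqv _ _ _ _ 'I_1 _ _ (const1 c) (fun=> Cc)) ab.
split; first exact: (eqv_le (inr ord0) (inl i) ab).
exact: (eqv_le (inl i) (inr ord0) ab).
Qed.

(* Every automorphism moves some point to a comparable one: [x /\ s x] and its
   image both lie below [s x]. *)
Lemma comparable_point (s : M -> M) : automorphism s ->
  exists m, le m (s m) \/ le (s m) m.
Proof.
move=> [hs _]; exists (meet p0 (s p0)).
apply: (@le_total_below _ treeM (s p0)); first exact: meet_ler.
by rewrite -(embedding_le _ _ hs); exact: meet_lel.
Qed.

(** Right existence for the pair [p0], [p1] gives the copy, and monotonicity passes to single
    points. Both notions of independence supply these two hypotheses. *)
Lemma incomparable_copy (ind : set M -> set M -> Prop) :
  (forall n (a : 'I_n -> M),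
     exists a', tp_eq a' a /\ ind (range a) (range a')) ->
  (forall A B A' B', finite_set A -> finite_set B ->
     ind A B -> A' `<=` A -> B' `<=` B -> ind A' B') ->
  exists q0 q1 : M, [/\ ~ le q0 q1, ~ le q1 q0 &
    forall x y, [set p0; p1] x -> [set q0; q1] y -> ind [set x] [set y]].
Proof.
move=> rex mono; have [a' [/tp_eq_eqv tpa' inda']] := rex _ (pair2 p0 p1).
exists (a' ord0), (a' ord_max); split.
- by move/(eqv_le ord0 ord_max tpa').
- by move/(eqv_le ord_max ord0 tpa').
move=> x y hx hy; apply: mono inda' _ _; try exact: finite_range.
  by move=> _ ->; case: hx => ->; [exists ord0|exists ord_max].
by move=> _ ->; case: hy => ->; [exists ord0|exists ord_max].
Qed.

Lemma no_shifty (s : M -> M) : ~ shifty s.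
Proof.
move=> [aut_s [ind [inv mono rex rsh]]].
have [q0 [q1 [q01 q10 indpq]]] := incomparable_copy rex mono.
(* All points share one type, so right shiftiness applies to every [b]: over [x], the point [y]
   looks like some iterate of [b]. *)
have shift x y b : ind [set x] [set y] -> exists k,
    (le x (iter k s b) <-> le x y) /\ (le (iter k s b) x <-> le y x).
  rewrite -(range_const1 y) => xy.
  have [k] := rsh _ _ (const1 b) _ (finite_set1 x) (one_type y b) xy.
  move=> /(tp_eq_over_le ord0 (erefl : [set x] x))[h1 h2].
  by exists k; split; symmetry.
have move_to m x y : ind [set x] [set y] -> exists g,
    [/\ automorphism g, g x = m & ind [set m] [set g y]].
  move=> xy; have [g [gaut /(_ ord0) gx]] := homM (one_type x m).
  exists g; split=> //; move: xy; rewrite (inv g) //; try exact: finite_set1.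
  by rewrite !image_set1 gx.
have iter_le m : (le m (s m) -> forall k, le m (iter k s m)) /\
                 (le (s m) m -> forall k, le (iter k s m) m).
  have [hs _] := aut_s.
  split=> h; elim=> [|k IH]; try exact: le_refl.
    by apply: (le_trans treeM h); rewrite iterS -embedding_le.
  by apply: le_trans h => //; rewrite iterS -embedding_le.
have [m [up|down]] := comparable_point aut_s.
  (* With [x] moved to [m] and [b] taken to be [m] itself, every iterate of [b] lies above the point
     it is compared with. *)
  have ind_le x y : ind [set x] [set y] -> le x y.
    move=> /(move_to m)[g [[hg _] gx xy]]; rewrite (embedding_le _ _ hg) gx.
    have [k [<- _]] := shift _ _ m xy; exact: (iter_le m).1.
  by case: (@le_total_below _ treeM q0 p0 p1) => //; apply/ind_le/indpq;
    (try by left); right.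
have ind_le x y : ind [set x] [set y] -> le y x.
  move=> /(move_to m)[g [[hg _] gx xy]]; rewrite (embedding_le _ _ hg) gx.
  have [k [_ <-]] := shift _ _ m xy; exact: (iter_le m).2.
by case: (@le_total_below _ treeM p0 q0 q1) => //; apply/ind_le/indpq;
  (try by left); right.
Qed.

Lemma no_canonical_independence_relation ind :
  ~ @canonical_independence_relation _ M ind.
Proof.
move=> [inv stat ext trl trr mono exi].
have fin1 (x : M) : finite_set [set x] by exact: finite_set1.
(* Existence makes [a] independent from the empty set, and extension on the right adjoins a copy of
   [a]. *)
have rex n (a : 'I_n -> M) :
    exists a', tp_eq a' a /\ ind set0 (range a) (range a').
  have [h _] := exi _ _ (finite_range a) (finite_set0 M).
  have [a' [tpa' ha']] := ext _ _ _ (finite_range a) (finite_set0 _) (finite_set0 _) h _ a.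
  by exists a'; move: tpa' ha'; rewrite set0U set0U.
have mono0 A B A' B' : finite_set A -> finite_set B ->
    ind set0 A B -> A' `<=` A -> B' `<=` B -> ind set0 A' B'.
  by move=> fA fB; exact: (mono _ _ set0).
have [q0 [q1 [q01 q10 indpq]]] := incomparable_copy rex mono0.
have same_type x y x' y' : ind set0 [set x] [set y] -> ind set0 [set x'] [set y'] ->
    (le x y <-> le x' y') /\ (le y x <-> le y' x').
  rewrite -(range_const1 x) -(range_const1 y) -(range_const1 x') -(range_const1 y').
  move=> h h'.
  have /tp_eq_eqv H := stat _ _ _ _ _ _ h h' (one_type _ _) (one_type _ _).
  split; first exact: (eqv_le (inl ord0) (inr ord0) H).
  exact: (eqv_le (inr ord0) (inl ord0) H).
(* If one independent pair were comparable, all would be so in the same direction, putting [p0] and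
   [p1] below [q0], or [q0] and [q1] below [p0]. *)
have incomparable x y : ind set0 [set x] [set y] -> ~ le x y /\ ~ le y x.
  move=> xy; split=> h.
    by case: (@le_total_below _ treeM q0 p0 p1) => //;
      [apply/(same_type p0 q0 x y _ xy).1|apply/(same_type p1 q0 x y _ xy).1] => //;
      apply/indpq; (try by left); right.
  by case: (@le_total_below _ treeM p0 q0 q1) => //;
    [apply/(same_type p0 q0 x y _ xy).2|apply/(same_type p0 q1 x y _ xy).2] => //;
    apply/indpq; (try by left); right.
have next x : exists y, ind set0 [set x] [set y].
  have [a' [_]] := rex _ (const1 x).
  rewrite range_const1 => h; exists (a' ord0); apply: mono0 h _ _ => //.
    exact: finite_range.
  by move=> _ ->; exists ord0.
(* For a copy [y] of [x2] over [x1], left transitivity puts [meet x1 y] strictly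
   below [meet x0 x1], while right transitivity makes it incomparable to [x0]. *)
have [x1 x01] := next p0; have [x2 x12] := next x1.
set x0 := p0 in x01 *.
pose A := [set x0; meet x0 x1]; pose d := pair2 x2 (meet x1 x2).
have finA : finite_set A by rewrite finite_setU.
(* Existence makes [A] independent from [x1] over [x1]; extension on the right adjoins a copy of the
   pair [x2], [meet x1 x2] over [x1]. *)
have [d' [tpd']] := ext _ _ _ finA (fin1 x1) (fin1 x1) (exi _ _ finA (fin1 x1)).1 _ d.
rewrite setUid in tpd' *.
set y := d' ord0; set z := d' ord_max => Ad'.
have {}tpd' := tp_eq_over_eqv (fun _ : 'I_1 => erefl x1) tpd'.
have zE : z = meet x1 y.
  by apply: (@eqv_meet _ _ _ _ _ (inr ord0) (inl ord0) (inl ord_max) (eqv_sym tpd')).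
have x1y : ind set0 [set x1] [set y].
  have /homM[g [gaut gE]] : tp_eq (pair2 x1 x2) (pair2 x1 y).
    apply/tp_eq_eqv.
    have := eqv_comp (pair2 (inr ord0) (inl ord0)) (eqv_sym tpd').
    by rewrite !pair2_comp.
  move: x12; rewrite (inv g) // image_set0 !image_set1.
  by have := gE ord0; have := gE ord_max; rewrite /pair2 /= => -> ->.
have {}Ad' : ind [set x1] A [set y; z].
  apply: mono Ad' _ _ => //; first by rewrite finite_setU; split=> //; exact: finite_range.
  by move=> _ [->|->]; right; [exists ord0|exists ord_max].
have mxy : ind set0 [set meet x0 x1] [set y].
  have h : ind set0 (A `|` [set x1]) [set y].
    apply: trl => //; rewrite setU0.
    by apply: mono Ad' _ _.
  by apply: mono0 h _ _ => //; [rewrite finite_setU|move=> _ ->; left; right].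
have x0z : ind set0 [set x0] [set z].
  have h : ind set0 [set x0] ([set y; z] `|` [set x1]).
    apply: trr => //; rewrite setU0.
    by apply: mono Ad' _ _ => // _ ->; left.
  by apply: mono0 h _ _ => // _ ->; left; right.
have [nmy nym] := incomparable _ _ mxy; have [nxz nzx] := incomparable _ _ x0z.
(* Both [meet x0 x1] and [z] lie below [x1]. One order puts [meet x0 x1] below [y], the other puts
   [z] below [x0]. *)
case: (@le_total_below _ treeM x1 (meet x0 x1) z).
- exact: meet_ler.
- by rewrite zE; exact: meet_lel.
- by move=> h; apply: nmy; apply: (le_trans treeM h); rewrite zE; exact: meet_ler.
- by move=> h; apply: nzx; apply: (le_trans treeM h); exact: meet_lel.
Qed.

End Obstruction.

(** * A criterion for countable trees, and transfer of its hypotheses *)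

(** Countability and quantifier elimination give homogeneity; irreflexivity of all relations gives a
    single type of points. *)
Lemma no_shifty_no_cir (I : finType) (sym : I -> R) (M : structure L) (p0 p1 : M) :
  (forall r, exists i, sym i = r) -> countable [set: M] -> tree M ->
  (forall r (x : M), ~ rel r x x) -> quantifier_elimination M ->
  ~ le p0 p1 -> ~ le p1 p0 ->
  (~ exists s : M -> M, shifty s) /\
  (~ exists ind : set M -> set M -> set M -> Prop,
       canonical_independence_relation ind).
Proof.
move=> symP ctbl tM irr qe p01 p10.
have homM := homogeneity symP qe ctbl.
have one_type (x y : M) : tp_eq (fun _ : 'I_1 => x) (fun _ => y).
  by apply/tp_eq_eqv/qe/point_meet_eqv.
split=> -[].
  by move=> s; exact: (no_shifty tM one_type homM p01 p10).
by move=> ind; exact: (no_canonical_independence_relation tM one_type homM p01 p10).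
Qed.

Lemma embedding_tree (M N : structure L) (h : M -> N) :
  embedding h -> tree N -> tree M.
Proof.
move=> hh /sat_tree_form H; apply/sat_tree_form => e.
by apply/(qf_embedding e hh qfree_tree_form).
Qed.

Lemma elementarily_equivalent_tree (M N : structure L) :
  models M (Th N) -> tree N -> tree M.
Proof.
move=> MN /sat_tree_form H; apply/sat_tree_form.
exact: elementarily_equivalent_sat MN H.
Qed.

Lemma elementarily_equivalent_irreflexive (M N : structure L) r :
  models M (Th N) -> (forall x : N, ~ rel r x x) -> forall x : M, ~ rel r x x.
Proof.
move=> MN irr x; pose phi : form L 'I_1 := Not (rel_form r (Var ord0) (Var ord0)).
have H : forall e : 'I_1 -> N, sat e phi by move=> e /sat_rel; exact: irr.
move=> xx; apply: (elementarily_equivalent_sat MN H (fun=> x)).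
exact/sat_rel.
Qed.

Definition incomparable_pair_form V : form L V :=
  let x := Var (Some None) in let y := Var None in
  Ex (Ex (And (Not (le_form x y)) (Not (le_form y x)))).

Lemma sat_incomparable_pair (M : structure L) (V : Type) (e : V -> M) :
  sat e (incomparable_pair_form V) <-> exists x y : M, ~ le x y /\ ~ le y x.
Proof.
split.
  move=> /sat_Ex[x /sat_Ex[y /sat_And[xy yx]]]; exists x, y.
  by split=> h; [apply: xy|apply: yx]; apply/sat_le.
move=> [x [y [xy yx]]]; apply/sat_Ex; exists x; apply/sat_Ex; exists y.
by apply/sat_And; split=> /sat_le.
Qed.

End BinaryStructures.

(** The empty tuple is treated apart because [generated_substructure] asks for a variable [v0]. *)
Lemma eqv_ord0 (L : language) (M : structure L) (a b : 'I_0 -> M) : eqv a b.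
Proof. by suff -> : a = b by []; apply/funext => -[]. Qed.

(** * The model completion of the theory of meet trees *)

Section DenseTrees.
Variable Tdt : theory tree_lang.
Hypothesis completion : model_completion meet_tree_theory Tdt.

Lemma meet_tree_theoryP (M : structure tree_lang) :
  models M meet_tree_theory <-> meet_tree M.
Proof.
split=> [H|H phi [_]]; last exact.
apply/(@sat_tree_form tree_rel Lt M)/holds_fclose/H; split.
  exact/universal_fclose/qfree_tree_form.
by move=> N /(@sat_tree_form tree_rel Lt N)/holds_fclose.
Qed.

(** A model of [Tdt] embeds in a meet tree, and the tree axioms descend along embeddings. *)
Lemma models_completion_tree (M : structure tree_lang) :
  models M Tdt -> @tree tree_rel Lt M.
Proof.
move=> MT; have [[_ cons _] _] := completion.
have [B [h [/meet_tree_theoryP tB hh]]] := cons M MT.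
exact: (embedding_tree hh tB).
Qed.

(* The completion together with the diagram of the substructure generated by
   the tuples is complete. *)
Lemma completion_qf_eqv (M N : structure tree_lang) (V : Type) (v0 : V)
    (a : V -> M) (b : V -> N) :
  models M Tdt -> models N Tdt -> qf_eqv a b -> eqv a b.
Proof.
move=> MT NT ab phi.
have [A [c [h [k [hh hk <- <- _]]]]] := generated_substructure v0 ab.
have AT : models A meet_tree_theory.
  exact/meet_tree_theoryP/(embedding_tree hh)/models_completion_tree.
have mdl (B : structure tree_lang) (d : A -> B) :
    models B Tdt -> embedding d -> models_with_diagram Tdt d.
  by move=> BT hd; split=> // psi [qpsi /(qf_embedding _ hd qpsi)].
have [_ /(_ A AT)[_ /(_ (frename phi c))]] := completion.
rewrite -(sat_rename phi c h) -(sat_rename phi c k) => -[H|H].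
  by split=> _; exact/H/mdl.
by split=> [/(H _ _ (mdl _ _ MT hh))|/(H _ _ (mdl _ _ NT hk))].
Qed.

Lemma completion_quantifier_elimination (M : structure tree_lang) :
  models M Tdt -> @quantifier_elimination tree_rel M.
Proof.
move=> MT [|n] a b ab; first exact: eqv_ord0.
apply: (completion_qf_eqv ord0) => //.
by apply: (@meet_eqv_qf tree_rel Lt M M) ab; exact: models_completion_tree.
Qed.

(** The smallest meet tree with incomparable points: a root [None] and two leaves. *)
Definition fork : structure tree_lang := {|
  carrier := option bool;
  carrier_inhabited := inhabits None;
  finterp := fun (_ : Defs.fsym tree_lang) (a : 'I_2 -> option bool) =>
    if a ord0 == a ord_max then a ord0 else None;
  rinterp := fun (_ : rsym tree_lang) (a : 'I_2 -> option bool) =>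
    a ord0 = None /\ a ord_max <> None |}.

Lemma meet_tree_fork : meet_tree fork.
Proof.
have E (x y : fork) : tmeet x y = if x == y :> option bool then x else None by [].
have F (x y : fork) : tlt x y <-> x = None /\ y <> None by [].
split.
- by move=> x /F[].
- by move=> x y z /F[-> _] /F[].
- move=> a x y; rewrite /tle !F.
  by case: a x y => [[]|] [[]|] [[]|]; intuition congruence.
- move=> x y; rewrite E /tle; split; [| |move=> z]; rewrite !F;
  by case: x y => [[]|] [[]|] //=; intuition congruence.
Qed.

(** Completeness with the diagram of [fork] supplies a model [B] of [Tdt] containing a copy of it. A
    point of [M] and the root of that copy have the same type, so the existence of incomparable
    points passes from [B] to [M]. *)
Lemma completion_incomparable (M : structure tree_lang) : models M Tdt ->
  exists x y : M, ~ @le tree_rel Lt M x y /\ ~ @le tree_rel Lt M y x.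
Proof.
move=> MT; have [x] := carrier_inhabited M.
have [_ /(_ fork)] := completion.
case; first exact/meet_tree_theoryP/meet_tree_fork.
move=> [B [c [BT cB]]] _.
have tM := models_completion_tree MT; have tB := models_completion_tree BT.
have : @eqv tree_lang M B 'I_1 (fun=> x) (fun=> c None).
  apply: (completion_qf_eqv ord0) => //; apply: (meet_eqv_qf tM tB).
  by apply: (point_meet_eqv _ tM tB) => -[]; [case: tM => + _ _ _|case: tB => + _ _ _]; apply.
move=> /(_ (incomparable_pair_form Lt 'I_1)); rewrite !sat_incomparable_pair => ->.
exists (c (Some true)), (c (Some false)).
split=> /(@sat_le tree_rel Lt B _ c (Var _) (Var _)).
  apply: (cB (Not (@le_form tree_rel Lt fork (Var _) (Var _)))); split=> //.
  by move=> /sat_le[[]|].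
apply: (cB (Not (@le_form tree_rel Lt fork (Var _) (Var _)))); split=> //.
by move=> /sat_le[[]|].
Qed.

Lemma dense_tree_no_shifty_no_cir (M : structure tree_lang) :
  countable [set: M] -> models M Tdt ->
  (~ exists s : M -> M, shifty s) /\
  (~ exists ind : set M -> set M -> set M -> Prop,
       canonical_independence_relation ind).
Proof.
move=> ctbl MT; have [x [y [xy yx]]] := completion_incomparable MT.
have tM := models_completion_tree MT.
apply: (@no_shifty_no_cir tree_rel Lt unit (fun=> Lt) M x y _ ctbl tM _ _ xy yx).
- by case; exists tt.
- by case: tM => irr _ _ _ [].
- exact: completion_quantifier_elimination.
Qed.

End DenseTrees.

(** * Lexicographically ordered trees and their limit *)

Section LexTrees.

Lemma common_prefix_prefixl s t : prefix (common_prefix s t) s.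
Proof.
elim: s t => [|x s IH] [|y t] //=; case: eqP => //= _.
by rewrite eqxx IH.
Qed.

Lemma common_prefixC s t : common_prefix s t = common_prefix t s.
Proof.
by elim: s t => [|x s IH] [|y t] //=; rewrite eq_sym; case: eqP => // ->; rewrite IH.
Qed.

Lemma prefix_common_prefix u s t :
  prefix u s -> prefix u t -> prefix u (common_prefix s t).
Proof.
elim: u s t => [|z u IH] [|x s] [|y t] //=; rewrite ?prefix0s //.
by move=> /andP[/eqP <- us] /andP[/eqP <- ut]; rewrite eqxx /= eqxx IH.
Qed.

Lemma prefix_total_below (u s t : seq nat) :
  prefix s u -> prefix t u -> prefix s t \/ prefix t s.
Proof.
rewrite !prefixE => /eqP su /eqP tu.
case: (leqP (size s) (size t)) => h; [left|right]; apply/eqP.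
  by rewrite -[X in take _ X]tu take_takel.
by rewrite -[X in take _ X]su take_takel // ltnW.
Qed.

Lemma le_omega_tree (s t : seq nat) :
  @le lextree_rel LexLt omega_tree s t <-> prefix s t.
Proof.
rewrite /le /rel /= /strict_prefix /pair2 /=.
split=> [[/andP[]//|->]|st]; first exact: prefix_refl.
by have [->|ne] := eqVneq s t; [right|left; rewrite st].
Qed.

Lemma tree_omega_tree : @tree lextree_rel LexLt omega_tree.
Proof.
have prefix_antisym (s t : seq nat) : prefix s t -> prefix t s -> s = t.
  move=> /prefixP[u ->] /prefixP[v]; rewrite -catA -[LHS]cats0 => /eqP.
  by rewrite eqseq_cat // eqxx /= => /eqP; case: u => // *; rewrite cats0.
split.
- by move=> s; rewrite /rel /= /strict_prefix /pair2 /= eqxx andbF.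
- move=> s t u; rewrite /rel /= /strict_prefix /pair2 /=.
  move=> /andP[st nst] /andP[tu ntu]; rewrite (prefix_trans st tu) /=.
  by apply: contraNneq nst => su; apply/eqP/prefix_antisym; rewrite // su.
- move=> u s t /le_omega_tree su /le_omega_tree tu.
  by have [|] := prefix_total_below su tu => /le_omega_tree; [left|right].
- move=> s t; have mE : meet (M := omega_tree) s t = common_prefix s t by [].
  split; rewrite ?mE; first by apply/le_omega_tree/common_prefix_prefixl.
    by apply/le_omega_tree; rewrite common_prefixC common_prefix_prefixl.
  by move=> u /le_omega_tree us /le_omega_tree ut; apply/le_omega_tree/prefix_common_prefix.
Qed.

Lemma omega_tree_irreflexive r (s : seq nat) : ~ @rel lextree_rel omega_tree r s s.
Proof.
have ss : common_prefix s s = s by elim: s => //= x t IH; rewrite eqxx IH.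
case: r; rewrite /rel /= /seq_lex /strict_prefix /pair2 /= eqxx andbF //.
by rewrite ss ltnn.
Qed.

Variable N : structure lextree_lang.
Hypothesis limN : fraisse_limit (age omega_tree) N.

(** A tuple of [A] generates a structure in the age of [A], hence in that of [B], where the
    quantifier-free formula can be evaluated on a copy. *)
Lemma age_sat (A B : structure lextree_lang) n (phi : form lextree_lang 'I_n.+1) :
  age A `<=` age B -> qfree phi ->
  (forall e : 'I_n.+1 -> B, sat e phi) -> forall e : 'I_n.+1 -> A, sat e phi.
Proof.
move=> AB qphi H e.
have [C [c [h [_ [hh _ <- _ gen]]]]] :=
  @generated_substructure _ _ _ _ ord0 e e (fun _ _ => iff_refl _).
have [_ [k hk]] : age B C by apply: AB; split; [exists n.+1, c|exists h].
by apply/(qf_embedding c hh qphi)/(qf_embedding c hk qphi); exact: H.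
Qed.

Let ageN : age N = age omega_tree.
Proof. by case: limN. Qed.

Lemma limit_sat n (phi : form lextree_lang 'I_n.+1) : qfree phi ->
  (forall e : 'I_n.+1 -> omega_tree, sat e phi) <-> (forall e : 'I_n.+1 -> N, sat e phi).
Proof. by move=> qphi; split; apply: age_sat; rewrite // ageN. Qed.

Lemma tree_limit : @tree lextree_rel LexLt N.
Proof. by apply/sat_tree_form/limit_sat => //; apply/sat_tree_form/tree_omega_tree. Qed.

Lemma limit_irreflexive r (x : N) : ~ @rel lextree_rel N r x x.
Proof.
pose phi : form lextree_lang 'I_1 := Not (@rel_form lextree_rel _ r (Var ord0) (Var ord0)).
have : forall e : 'I_1 -> N, sat e phi.
  by apply/limit_sat => // e /sat_rel; exact: omega_tree_irreflexive.
by move=> /(_ (fun=> x)) H xx; apply/H/sat_rel.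
Qed.

(** Comparability of all points is a quantifier-free condition on pairs, so it would pass to
    [omega_tree], where [[:: 0]] and [[:: 1]] refute it. *)
Lemma limit_incomparable : exists x y : N,
  ~ @le lextree_rel LexLt N x y /\ ~ @le lextree_rel LexLt N y x.
Proof.
apply: contrapT => H.
pose phi : form lextree_lang 'I_2 :=
  Or (@le_form lextree_rel LexLt _ (Var ord0) (Var ord_max))
     (@le_form lextree_rel LexLt _ (Var ord_max) (Var ord0)).
have : forall e : 'I_2 -> omega_tree, sat e phi.
  apply/limit_sat => // e; apply/sat_Or; rewrite !sat_le.
  apply: contrapT => /not_orP h; apply: H.
  by exists (e ord0), (e ord_max).
by move=> /(_ (pair2 [:: 0] [:: 1]))/sat_Or[]/sat_le/le_omega_tree.
Qed.

(** Equal quantifier-free types give isomorphic generated substructures; ultrahomogeneity extends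
    the isomorphism to an automorphism, which preserves all formulas. *)
Lemma limit_quantifier_elimination : @quantifier_elimination lextree_rel N.
Proof.
move=> [|n] a b ab; first exact: eqv_ord0.
have qab := meet_eqv_qf tree_limit tree_limit ab.
have [A [c [h [k [hh hk <- <- gen]]]]] := generated_substructure ord0 qab.
have [_ _ homN] := limN.
have [|s [saut sE]] := homN A k h _ hk hh; first by exists n.+1, c.
have -> : k \o c = s \o (h \o c) by apply/funext => i /=; rewrite sE.
exact: automorphism_elementary.
Qed.

(** The tree axioms, irreflexivity, quantifier elimination and the incomparable pair are established
    in [N] and pass to models of [Th N]. *)
Lemma lex_tree_no_shifty_no_cir (M : structure lextree_lang) :
  countable [set: M] -> models M (Th N) ->
  (~ exists s : M -> M, shifty s) /\
  (~ exists ind : set M -> set M -> set M -> Prop,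
       canonical_independence_relation ind).
Proof.
move=> ctbl MN.
have symP r : exists b : bool, (if b then LexLt else LexLex) = r.
  by case: r; [exists true|exists false].
have [x [y [xy yx]]] : exists x y : M,
    ~ @le lextree_rel LexLt M x y /\ ~ @le lextree_rel LexLt M y x.
  have [x] := carrier_inhabited M.
  pose phi := @incomparable_pair_form lextree_rel LexLt 'I_1.
  have H (e : 'I_1 -> N) : sat e phi.
    exact/sat_incomparable_pair/limit_incomparable.
  exact/(sat_incomparable_pair _ (fun=> x))/(elementarily_equivalent_sat MN H).
apply: (@no_shifty_no_cir lextree_rel LexLt bool _ M x y symP ctbl _ _ _ xy yx).
- exact: elementarily_equivalent_tree MN tree_limit.
- by move=> r; apply: elementarily_equivalent_irreflexive MN _; exact: limit_irreflexive.
- exact: (quantifier_elimination_transfer symP MN limit_quantifier_elimination).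
Qed.

End LexTrees.

Theorem corollary6p10 :
  (forall Tdt : theory tree_lang,
     model_completion meet_tree_theory Tdt ->
     forall M : structure tree_lang,
       countable [set: M] -> models M Tdt ->
       (~ exists s : M -> M, shifty s) /\
       (~ exists ind : set M -> set M -> set M -> Prop,
            canonical_independence_relation ind)) /\
  (forall N : structure lextree_lang,
     fraisse_limit (age omega_tree) N ->
     forall M : structure lextree_lang,
       countable [set: M] -> models M (Th N) ->
       (~ exists s : M -> M, shifty s) /\
       (~ exists ind : set M -> set M -> set M -> Prop,
            canonical_independence_relation ind)).
Proof.
split=> [Tdt completion M|N limN M].
  exact: dense_tree_no_shifty_no_cir.
exact: lex_tree_no_shifty_no_cir.
Qed.
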